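(* Let $g=\sum_{n=0}^\infty b_nz^n$ be a formal power series and $f=\sum_{n\in\mathbb Z}a_nz^n$ a formal Laurent series over $\mathbb C$, and assume that $(|g|'\circ|f|)\,|f|'$ exists, where $|f|:=\sum_{n\in\mathbb Z}|a_n|z^n$, $|g|:=\sum_{n=0}^\infty|b_n|z^n$ and $|f|'$, $|g|'$ denote the formal derivatives of $|f|$, $|g|$. Then $(g'\circ f)f'$ and $(g\circ f)'$ exist and are equal.
   Context: A formal Laurent series over $\mathbb C$ is a mapping $f:\mathbb Z\to\mathbb C$, written $f=\sum_{n\in\mathbb Z}a_nz^n$ with $a_n=f(n)$ (arbitrarily many nonzero coefficients with negative index are allowed); formal power series are those whose coefficients with negative index vanish. For complex $(c_n)_{n\in\mathbb Z}$, $\sum_{n\in\mathbb Z}c_n:=\sum_{n=1}^\infty c_{-n}+\sum_{n=0}^\infty c_n$, convergent iff both one-sided series converge. The product of $g=\sum b_nz^n$ and $f=\sum a_nz^n$ is $gf:=\sum_{n\in\mathbb Z}\left(\sum_{m\in\mathbb Z}b_ma_{n-m}\right)z^n$, provided all sums over $m$ converge; otherwise $gf$ does not exist. Powers: $f^0:=1$ (coefficients $\delta_{n,0}$), $f^1:=f$, $f^k:=f^{k-1}f$ for $k>1$ provided $f^{k-1}$ and the product $f^{k-1}f$ exist; write $f^k=\sum_{n\in\mathbb Z}a_n^{(k)}z^n$. Formal derivative: $f':=\sum_{n\in\mathbb Z}(n+1)a_{n+1}z^n$. $\deg_+(g):=\sup\{n\ge0:b_n\ne0\}$, with $\sup\emptyset:=0$;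 it may be $+\infty$. Composition: for a formal power series $g=\sum_{k=0}^\infty b_kz^k$ and a formal Laurent series $f$, the composition $g\circ f$ exists iff $f^k$ exists for every integer $0\le k\le\deg_+(g)$ (for every $k\ge0$ if $\deg_+(g)=+\infty$) and $\sum_{k=0}^{\deg_+(g)}b_ka_n^{(k)}$ converges for all $n\in\mathbb Z$; then $g\circ f:=\sum_{n\in\mathbb Z}\left(\sum_{k=0}^{\deg_+(g)}b_ka_n^{(k)}\right)z^n$. An expression such as $(g'\circ f)f'$ exists iff the composition and the product occurring in it exist; $(g\circ f)'$ exists iff $g\circ f$ exists. *)

(* Defs.v *)
From Stdlib Require Import Reals ZArith.
From Coquelicot Require Import Coquelicot.

Open Scope C_scope.

(* [a n] is the coefficient of z^n. *)
Definition laurent := Z -> C.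

Definition power_series (g : laurent) : Prop :=
  forall n : Z, (n < 0)%Z -> g n = 0.

Definition absl (f : laurent) : laurent := fun n => RtoC (Cmod (f n)).

Definition deriv (f : laurent) : laurent :=
  fun n => RtoC (IZR (n + 1)) * f (n + 1)%Z.

(* Both one-sided series must converge separately; convergence need not be
   absolute. *)
Definition is_sumZ (c : Z -> C) (s : C) : Prop :=
  exists s1 s2 : C,
    is_series (fun n : nat => c (- Z.of_nat (S n))%Z) s1 /\
    is_series (fun n : nat => c (Z.of_nat n)) s2 /\
    s = s1 + s2.

(* The partial operations are relations: [is_mul g f h] says that the product
   gf exists and has the coefficients of [h]; similarly for [is_pow] and
   [is_comp]. *)
Definition is_mul (g f h : laurent) : Prop :=
  forall n : Z, is_sumZ (fun m => g m * f (n - m)%Z) (h n).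

(* f^1 is f outright, not the product 1 f; products start at k = 2. *)
Fixpoint is_pow (f : laurent) (k : nat) (p : laurent) : Prop :=
  match k with
  | O => forall n : Z, p n = if Z.eq_dec n 0 then 1 else 0
  | S k' =>
      match k' with
      | O => forall n : Z, p n = f n
      | S _ => exists q : laurent, is_pow f k' q /\ is_mul q f p
      end
  end.

(* Including the index 0 in the set gives the convention sup(empty) = 0. *)
Definition deg_plus (g : laurent) : Rbar :=
  Lub_Rbar (fun x : R =>
    x = 0%R \/ exists n : nat, g (Z.of_nat n) <> 0 /\ x = INR n).

(* The sum of [c k] over 0 <= k <= d, an infinite series when d = +oo and a
   finite sum (a series with null tail) when d is finite. *)
Definition is_sum_upto (d : Rbar) (c : nat -> C) (s : C) : Prop :=
  is_series (fun k : nat =>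
    if Rbar_le_dec (Finite (INR k)) d then c k else RtoC 0) s.

(* [p k] is the k-th power of f; it is unconstrained for k > deg_plus g, where
   that power need not exist. *)
Definition is_comp (g f h : laurent) : Prop :=
  power_series g /\
  exists p : nat -> laurent,
    (forall k : nat, Rbar_le (Finite (INR k)) (deg_plus g) ->
       is_pow f k (p k)) /\
    (forall n : Z,
       is_sum_upto (deg_plus g) (fun k => g (Z.of_nat k) * p k n) (h n)).

(* Main.v *)
Require Import Defs.
From Stdlib Require Import Reals ZArith List Permutation FinFun Lra Lia.
From Stdlib Require Import ClassicalEpsilon FunctionalExtensionality.
From Coquelicot Require Import Coquelicot.
Local Open Scope C_scope.

(** The series in the hypothesis have terms of eventually constant sign, so the
    hypothesis is really a statement about absolute convergence, and everything
    then follows from Fubini's theorem for unordered sums and the power rule.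

    Write [b_k] for the coefficients of [g], [F = |f|], and use the Euler
    operator [theta = z d/dz] in place of [d/dz]; the two differ by a shift of
    the index. The hypothesis says that [u = sum_k (k+1) |b_(k+1)| F^k] exists
    and that [u (theta F)] exists. In each coefficient of this product the terms
    [u_m (n-m) F_(n-m)] have one sign for large [m] and one sign for large [-m],
    so convergence is absolute ([is_mul_deriv_nneg]). Hence for every [n] the
    family
      [(m, k) |-> (k+1) b_(k+1) f^k_m (theta f)_(n-m)]
    is summable. Since [|n-m| >= 1] off the diagonal, the product [u F] converges
    absolutely as well ([mulable_of_theta]); this gives the existence of
    [F^(k+1)] whenever [b_(k+1) <> 0], also at the top exponent [deg g], which is
    not among the powers used by [g'], and it makes [sum_k b_k f^k_n] absolutely
    convergent because [(k+1) |b_(k+1)| >= |b_(k+1)|] ([W_summable]).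

    Summing the family over [k] first gives [((g' o f) (theta f))_n]. Summing
    over [m] first gives [sum_k (k+1) b_(k+1) (f^k (theta f))_n], which the power
    rule [theta (f^(k+1)) = (k+1) f^k (theta f)] turns into
    [n sum_k b_(k+1) f^(k+1)_n = (theta (g o f))_n] ([chain_rule]).

    Products of Laurent series are in general not associative, so the power rule
    ([theta_pw]) needs care. It is proved by induction with the product rule, and
    each step exchanges two factors of a triple product, [(a b) c = (a c) b]
    ([conv_right_comm]). This is allowed because the triple product converges
    absolutely: it is dominated by [(F^k F) (theta F) = F^(k+1) (theta F)], which
    exists by assumption, and nonnegative terms may be rearranged freely. The
    assumption for the next lower power follows by cancelling a nonzero
    coefficient of [F] ([mulable_drop_factor]). *)

(** * Unordered sums of complex families *)

Definition fsum {I : Type} (c : I -> C) (L : list I) : C :=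
  fold_right (fun i acc => c i + acc) 0 L.

Definition asum {I : Type} (c : I -> C) (L : list I) : R :=
  fold_right (fun i acc => (Cmod (c i) + acc)%R) 0%R L.

Definition summable {I : Type} (c : I -> C) : Prop :=
  exists M : R, forall L : list I, NoDup L -> (asum c L <= M)%R.

(** Convergence of the finite partial sums along the net of finite subsets of
    the index type, a finite subset being a list without repetition. *)
Definition has_sum {I : Type} (c : I -> C) (s : C) : Prop :=
  forall eps : R, (0 < eps)%R ->
    exists L0 : list I, forall L : list I,
      NoDup L -> incl L0 L -> (Cmod (fsum c L - s) < eps)%R.

Definition tsum {I : Type} (c : I -> C) : C :=
  epsilon (inhabits (RtoC 0)) (has_sum c).

(** A predicate on complex numbers rather than a separate real type, so that
    dominating families are summed and multiplied by the same operations as the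
    families that they dominate. *)
Definition nneg (z : C) : Prop := z = RtoC (Cmod z).

Definition eq_dec_classic {I : Type} (x y : I) : {x = y} + {x <> y} :=
  excluded_middle_informative (x = y).

Lemma nneg_RtoC (r : R) : (0 <= r)%R -> nneg (RtoC r).
Proof. intros H; unfold nneg; rewrite Cmod_R, Rabs_pos_eq; auto. Qed.

Lemma nneg_mult (x y : C) : nneg x -> nneg y -> nneg (x * y).
Proof.
  intros Hx Hy; unfold nneg; rewrite Cmod_mult, RtoC_mult, <- Hx, <- Hy; auto.
Qed.

Lemma fsum_app {I} (c : I -> C) L1 L2 :
  fsum c (L1 ++ L2) = fsum c L1 + fsum c L2.
Proof.
  induction L1 as [|a L1 IH]; simpl; [ring|]. rewrite IH; ring.
Qed.

Lemma asum_app {I} (c : I -> C) L1 L2 :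
  asum c (L1 ++ L2) = (asum c L1 + asum c L2)%R.
Proof.
  induction L1 as [|a L1 IH]; simpl; [ring|]. rewrite IH; ring.
Qed.

Lemma fsum_perm {I} (c : I -> C) L1 L2 :
  Permutation L1 L2 -> fsum c L1 = fsum c L2.
Proof.
  induction 1; simpl; auto; try congruence. ring.
Qed.

Lemma asum_perm {I} (c : I -> C) L1 L2 :
  Permutation L1 L2 -> asum c L1 = asum c L2.
Proof.
  induction 1; simpl; auto; try congruence. ring.
Qed.

Lemma fsum_map {I J} (c : I -> C) (phi : J -> I) L :
  fsum c (map phi L) = fsum (fun j => c (phi j)) L.
Proof. induction L; simpl; congruence. Qed.

Lemma asum_map {I J} (c : I -> C) (phi : J -> I) L :
  asum c (map phi L) = asum (fun j => c (phi j)) L.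
Proof. induction L; simpl; congruence. Qed.

Lemma asum_ge0 {I} (c : I -> C) L : (0 <= asum c L)%R.
Proof.
  induction L as [|a L IH]; simpl; [lra|]. generalize (Cmod_ge_0 (c a)); lra.
Qed.

Lemma Cmod_fsum_le {I} (c : I -> C) L : (Cmod (fsum c L) <= asum c L)%R.
Proof.
  induction L as [|a L IH]; simpl; [rewrite Cmod_0; lra|].
  eapply Rle_trans; [apply Cmod_triangle|lra].
Qed.

Lemma asum_le {I} (c d : I -> C) L :
  (forall i, Cmod (c i) <= Cmod (d i))%R -> (asum c L <= asum d L)%R.
Proof.
  intros H; induction L as [|a L IH]; simpl; [lra|].
  specialize (H a); lra.
Qed.

Lemma fsum_nneg {I} (c : I -> C) L :
  (forall i, nneg (c i)) -> fsum c L = RtoC (asum c L).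
Proof.
  intros H; induction L as [|a L IH]; simpl; auto.
  rewrite IH, (H a), RtoC_plus, Cmod_R, (Rabs_pos_eq (Cmod (c a))); auto.
  apply Cmod_ge_0.
Qed.

Lemma NoDup_incl_split {I} (L0 L : list I) :
  NoDup L0 -> NoDup L -> incl L0 L ->
  exists R, NoDup R /\ (forall x, In x R -> ~ In x L0) /\
    Permutation L (L0 ++ R).
Proof.
  intros H0 HL Hi.
  set (R := filter (fun x => if in_dec eq_dec_classic x L0 then false else true) L).
  assert (HR : forall x, In x R <-> In x L /\ ~ In x L0).
  { intros x; unfold R; rewrite filter_In.
    destruct (in_dec eq_dec_classic x L0); intuition discriminate. }
  assert (HN : NoDup R) by (apply NoDup_filter; auto).
  exists R; split; [auto|split].
  - intros x Hx; apply HR; auto.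
  - apply NoDup_Permutation; auto.
    + apply NoDup_app; auto. intros a Ha Hb; apply HR in Hb; tauto.
    + intros x; rewrite in_app_iff, HR.
      destruct (in_dec eq_dec_classic x L0) as [h|h]; intuition.
Qed.

Lemma asum_incl {I} (c : I -> C) L0 L :
  NoDup L0 -> NoDup L -> incl L0 L -> (asum c L0 <= asum c L)%R.
Proof.
  intros H0 HL Hi. destruct (NoDup_incl_split L0 L H0 HL Hi) as (R & _ & _ & HP).
  rewrite (asum_perm c _ _ HP), asum_app. generalize (asum_ge0 c R); lra.
Qed.

Lemma incl_nodup {I} (L : list I) : incl L (nodup eq_dec_classic L).
Proof. intros x Hx; apply nodup_In; auto. Qed.

Lemma summable_le {I} (c d : I -> C) :
  (forall i, Cmod (c i) <= Cmod (d i))%R -> summable d -> summable c.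
Proof.
  intros H [M HM]; exists M; intros L HL.
  eapply Rle_trans; [apply asum_le, H|auto].
Qed.

Lemma summable_scal {I} (c : I -> C) (k : C) :
  summable c -> summable (fun i => k * c i).
Proof.
  intros [M HM]; exists (Cmod k * M)%R; intros L HL.
  replace (asum (fun i => k * c i) L) with (Cmod k * asum c L)%R.
  - apply Rmult_le_compat_l; [apply Cmod_ge_0|auto].
  - clear HL; induction L as [|a L IH]; simpl; [ring|].
    rewrite <- IH, Cmod_mult; ring.
Qed.

Lemma summable_inj {I J} (phi : J -> I) (c : I -> C) :
  Injective phi -> summable c -> summable (fun j => c (phi j)).
Proof.
  intros Hp [M HM]; exists M; intros L HL.
  rewrite <- asum_map. apply HM, Injective_map_NoDup; auto.
Qed.

Lemma summable_0 {I} (c : I -> C) : (forall i, c i = 0) -> summable c.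
Proof.
  intros H; exists 0%R; intros L _.
  induction L as [|a L IH]; simpl; [lra|]. rewrite H, Cmod_0; lra.
Qed.

(** Changing one term does not affect summability; the bound on the moduli may
    thus fail at one index. *)
Lemma summable_except {I} (a : I) (c d : I -> C) :
  (forall i, i <> a -> Cmod (c i) <= Cmod (d i))%R -> summable d -> summable c.
Proof.
  intros H [M HM]; exists (M + Cmod (c a))%R; intros L HL.
  assert (Hg : (~ In a L -> asum c L <= asum d L)%R /\
    (asum c L <= asum d L + Cmod (c a))%R).
  { induction L as [|x L IH].
    - simpl; generalize (Cmod_ge_0 (c a)); split; intros; lra.
    - inversion HL as [|? ? Hx HL']; subst. destruct (IH HL') as [IH1 IH2].
      simpl. destruct (eq_dec_classic x a) as [->|Hxa].
      + specialize (IH1 Hx). generalize (Cmod_ge_0 (d a)).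
        split; [tauto|lra].
      + specialize (H x Hxa). split; [intros h; assert (~ In a L) by tauto|].
        * specialize (IH1 H0); lra.
        * lra. }
  generalize (HM L HL). lra.
Qed.

Lemma has_sum_unique {I} (c : I -> C) (s t : C) :
  has_sum c s -> has_sum c t -> s = t.
Proof.
  intros Hs Ht. apply Ceq_minus, Cmod_eq_0.
  destruct (Rle_lt_or_eq_dec 0 (Cmod (s - t)) (Cmod_ge_0 _)) as [h|h]; auto.
  exfalso.
  destruct (Hs (Cmod (s - t) / 2)%R) as [L1 H1]; [lra|].
  destruct (Ht (Cmod (s - t) / 2)%R) as [L2 H2]; [lra|].
  set (L := nodup eq_dec_classic (L1 ++ L2)).
  assert (HL : NoDup L) by apply NoDup_nodup.
  assert (Hi : incl (L1 ++ L2) L) by apply incl_nodup.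
  apply incl_app_inv in Hi; destruct Hi as [Hi1 Hi2].
  specialize (H1 L HL Hi1); specialize (H2 L HL Hi2).
  assert (Cmod (s - t) <= Cmod (fsum c L - t) + Cmod (fsum c L - s))%R; [|lra].
  rewrite <- (Cmod_opp (fsum c L - s)).
  replace (s - t) with ((fsum c L - t) + - (fsum c L - s)) by ring.
  apply Cmod_triangle.
Qed.

Lemma has_sum_plus {I} (c d : I -> C) (s t : C) :
  has_sum c s -> has_sum d t -> has_sum (fun i => c i + d i) (s + t).
Proof.
  intros Hs Ht eps He.
  destruct (Hs (eps / 2)%R) as [L1 H1]; [lra|].
  destruct (Ht (eps / 2)%R) as [L2 H2]; [lra|].
  exists (L1 ++ L2); intros L HL Hi.
  apply incl_app_inv in Hi; destruct Hi as [Hi1 Hi2].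
  specialize (H1 L HL Hi1); specialize (H2 L HL Hi2).
  replace (fsum (fun i => c i + d i) L) with (fsum c L + fsum d L).
  - replace (fsum c L + fsum d L - (s + t))
      with ((fsum c L - s) + (fsum d L - t)) by ring.
    eapply Rle_lt_trans; [apply Cmod_triangle|lra].
  - clear; induction L as [|a L IH]; simpl; [ring|]. rewrite <- IH; ring.
Qed.

Lemma has_sum_scal {I} (c : I -> C) (k s : C) :
  has_sum c s -> has_sum (fun i => k * c i) (k * s).
Proof.
  intros Hs eps He.
  assert (Hk : (0 < Cmod k + 1)%R) by (generalize (Cmod_ge_0 k); lra).
  destruct (Hs (eps / (Cmod k + 1))%R) as [L0 H0]; [apply Rdiv_lt_0_compat; auto|].
  exists L0; intros L HL Hi; specialize (H0 L HL Hi).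
  replace (fsum (fun i => k * c i) L) with (k * fsum c L).
  - replace (k * fsum c L - k * s) with (k * (fsum c L - s)) by ring.
    rewrite Cmod_mult. apply Rle_lt_trans with ((Cmod k + 1) * Cmod (fsum c L - s))%R.
    + apply Rmult_le_compat_r; [apply Cmod_ge_0|lra].
    + apply (Rmult_lt_compat_l (Cmod k + 1)) in H0; auto.
      replace ((Cmod k + 1) * (eps / (Cmod k + 1)))%R with eps in H0; auto.
      field; lra.
  - clear; induction L as [|a L IH]; simpl; [ring|]. rewrite <- IH; ring.
Qed.

Lemma has_sum_single {I} (a : I) (c : I -> C) :
  (forall i, i <> a -> c i = 0) -> has_sum c (c a).
Proof.
  intros H eps He; exists (a :: nil); intros L HL Hi.
  destruct (NoDup_incl_split (a :: nil) L) as (R & _ & HR & HP); auto.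
  { constructor; [simpl; tauto|constructor]. }
  rewrite (fsum_perm c _ _ HP); simpl.
  assert (HR0 : fsum c R = 0).
  { clear HP. induction R as [|x R IH]; simpl; auto.
    rewrite IH, H; [ring| |].
    - intros ->; apply (HR a); simpl; auto.
    - intros y Hy; apply HR; simpl; auto. }
  rewrite HR0. replace (c a + 0 - c a) with (RtoC 0) by ring.
  rewrite Cmod_0; auto.
Qed.

Lemma has_sum_bij {I J} (phi : J -> I) (psi : I -> J) (c : I -> C) (s : C) :
  (forall j, psi (phi j) = j) -> (forall i, phi (psi i) = i) ->
  has_sum c s -> has_sum (fun j => c (phi j)) s.
Proof.
  intros H1 H2 Hs eps He. destruct (Hs eps He) as [L0 H0].
  exists (map psi L0); intros L HL Hi. rewrite <- fsum_map. apply H0.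
  - apply Injective_map_NoDup; auto. intros x y Hxy.
    rewrite <- (H1 x), <- (H1 y); congruence.
  - intros x Hx. rewrite <- (H2 x). apply in_map, Hi, in_map; auto.
Qed.

Lemma asum_le_sum {I} (c d : I -> C) (t : C) :
  (forall i, Cmod (c i) <= Cmod (d i))%R -> (forall i, nneg (d i)) ->
  has_sum d t -> forall L, NoDup L -> (asum c L <= Cmod t)%R.
Proof.
  intros Hcd Hd Ht L HL. apply Rle_trans with (asum d L); [apply asum_le; auto|].
  apply le_epsilon; intros eps He. destruct (Ht eps He) as [L0 H0].
  set (L' := nodup eq_dec_classic (L ++ L0)).
  assert (HL' : NoDup L') by apply NoDup_nodup.
  assert (Hi : incl (L ++ L0) L') by apply incl_nodup.
  apply incl_app_inv in Hi; destruct Hi as [Hi1 Hi2].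
  apply Rle_trans with (asum d L'); [apply asum_incl; auto|].
  specialize (H0 L' HL' Hi2). rewrite (fsum_nneg d L' Hd) in H0.
  rewrite <- (Rabs_pos_eq (asum d L')) by apply asum_ge0. rewrite <- Cmod_R.
  replace (RtoC (asum d L')) with (t + (RtoC (asum d L') - t)) by ring.
  eapply Rle_trans; [apply Cmod_triangle|lra].
Qed.

Lemma has_sum_le {I} (c d : I -> C) (s t : C) :
  (forall i, Cmod (c i) <= Cmod (d i))%R -> (forall i, nneg (d i)) ->
  has_sum c s -> has_sum d t -> (Cmod s <= Cmod t)%R.
Proof.
  intros Hcd Hd Hs Ht. apply le_epsilon; intros eps He.
  destruct (Hs eps He) as [L0 H0].
  set (L := nodup eq_dec_classic L0).
  specialize (H0 L (NoDup_nodup _ _) (incl_nodup _)).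
  assert (H1 := asum_le_sum c d t Hcd Hd Ht L (NoDup_nodup _ _)).
  assert (H2 := Cmod_fsum_le c L).
  rewrite <- Cmod_opp in H0.
  replace s with (fsum c L + - (fsum c L - s)) by ring.
  eapply Rle_trans; [apply Cmod_triangle|lra].
Qed.

Lemma has_sum_nneg {I} (c : I -> C) (s : C) :
  (forall i, nneg (c i)) -> has_sum c s -> nneg s.
Proof.
  intros Hc Hs. unfold nneg. apply Ceq_minus, Cmod_eq_0.
  apply Rle_antisym; [|apply Cmod_ge_0].
  apply le_epsilon; intros eps He. destruct (Hs (eps / 2)%R) as [L0 H0]; [lra|].
  set (L := nodup eq_dec_classic L0).
  specialize (H0 L (NoDup_nodup _ _) (incl_nodup _)).
  rewrite fsum_nneg in H0; auto.
  set (x := asum c L) in *.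
  assert (Hx : (0 <= x)%R) by apply asum_ge0.
  assert (H1 : (Cmod s <= x + Cmod (RtoC x - s))%R).
  { rewrite <- (Cmod_opp (RtoC x - s)). rewrite <- (Rabs_pos_eq x) at 1 by auto.
    rewrite <- Cmod_R. replace s with (RtoC x + - (RtoC x - s)) at 1 by ring.
    apply Cmod_triangle. }
  assert (H2 : (x <= Cmod s + Cmod (RtoC x - s))%R).
  { rewrite <- (Rabs_pos_eq x) at 1 by auto. rewrite <- Cmod_R.
    replace (RtoC x) with (s + (RtoC x - s)) at 1 by ring.
    apply Cmod_triangle. }
  replace (s - RtoC (Cmod s)) with (- (RtoC x - s) + RtoC (x - Cmod s))
    by (rewrite RtoC_minus; ring).
  eapply Rle_trans; [apply Cmod_triangle|]. rewrite Cmod_opp, Cmod_R.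
  assert (Rabs (x - Cmod s) <= Cmod (RtoC x - s))%R by (apply Rabs_le; lra). lra.
Qed.

Lemma summable_has_sum_nneg {I} (c : I -> C) :
  (forall i, nneg (c i)) -> summable c -> exists s, has_sum c s.
Proof.
  intros Hc [M HM].
  destruct (completeness (fun x => exists L, NoDup L /\ x = asum c L)) as [S [HS1 HS2]].
  - exists M; intros x (L & HL & ->); auto.
  - exists 0%R, nil; split; [constructor|auto].
  - exists (RtoC S); intros eps He.
    destruct (excluded_middle_informative
      (exists L, NoDup L /\ (S - eps < asum c L)%R)) as [(L0 & HL0 & H0)|Hn].
    + exists L0; intros L HL Hi. rewrite fsum_nneg by auto.
      rewrite <- RtoC_minus, Cmod_R.
      assert (asum c L0 <= asum c L)%R by (apply asum_incl; auto).
      assert (asum c L <= S)%R by (apply HS1; exists L; auto).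
      apply Rabs_lt_between; lra.
    + exfalso. assert (S <= S - eps)%R; [|lra]. apply HS2.
      intros x (L & HL & ->). apply Rnot_lt_le. intros h; apply Hn; eauto.
Qed.

(** Completeness of the complex numbers enters only through suprema of reals:
    the real and imaginary parts are differences of nonnegative families. *)
Lemma summable_has_sum {I} (c : I -> C) : summable c -> exists s, has_sum c s.
Proof.
  intros Hc.
  assert (Hsh : forall r : C -> R, (forall z, Rabs (r z) <= Cmod z)%R ->
    exists s, has_sum (fun i => RtoC (Cmod (c i) + r (c i))) s).
  { intros r Hr. apply summable_has_sum_nneg.
    - intros i; apply nneg_RtoC. generalize (Hr (c i)).
      intros h; apply Rabs_le_between in h; lra.
    - apply summable_le with (fun i => RtoC 2 * c i); [|apply summable_scal; auto].
      intros i. rewrite Cmod_mult, !Cmod_R, (Rabs_pos_eq 2) by lra.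
      generalize (Hr (c i)). intros h; apply Rabs_le_between in h.
      apply Rabs_le; lra. }
  destruct (Hsh (fun _ => 0%R)) as [s0 H0].
  { intros z; rewrite Rabs_R0; apply Cmod_ge_0. }
  destruct (Hsh fst) as [s1 H1].
  { intros z; eapply Rle_trans; [apply Rmax_l|apply Rmax_Cmod]. }
  destruct (Hsh snd) as [s2 H2].
  { intros z; eapply Rle_trans; [apply Rmax_r|apply Rmax_Cmod]. }
  exists (s1 + (Ci * s2 + (- (1 + Ci)) * s0)).
  assert (H := has_sum_plus _ _ _ _ H1 (has_sum_plus _ _ _ _
    (has_sum_scal _ Ci _ H2) (has_sum_scal _ (- (1 + Ci)) _ H0))).
  replace c with (fun i => RtoC (Cmod (c i) + fst (c i)) +
    (Ci * RtoC (Cmod (c i) + snd (c i)) + - (1 + Ci) * RtoC (Cmod (c i) + 0))).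
  - exact H.
  - apply functional_extensionality; intros i.
    destruct (c i) as [x y]. apply injective_projections; simpl; ring.
Qed.

Lemma tsum_spec {I} (c : I -> C) : summable c -> has_sum c (tsum c).
Proof. intros H. unfold tsum. apply epsilon_spec, summable_has_sum, H. Qed.

Lemma tsum_unique {I} (c : I -> C) (s : C) : has_sum c s -> tsum c = s.
Proof.
  intros H. apply (has_sum_unique c); auto.
  unfold tsum. apply epsilon_spec; eauto.
Qed.

(** The common source of both statements on marginals. The error [delta] is
    shared out among the finitely many slices in [A]; the set [B0] makes the
    approximating set of pairs as large as the convergence of the double sum
    requires. *)
Lemma slices_approx {I J} (c : I -> J -> C) (G : I -> C) :
  (forall i, has_sum (c i) (G i)) ->
  forall (A : list I) (B0 : list J) (delta : R), (0 < delta)%R -> NoDup A ->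
  exists L : list (I * J), NoDup L /\
    (forall p, In p L -> In (fst p) A) /\
    (forall i j, In i A -> In j B0 -> In (i, j) L) /\
    (Cmod (fsum (fun p => c (fst p) (snd p)) L - fsum G A) < delta)%R /\
    (asum G A <= asum (fun p => c (fst p) (snd p)) L + delta)%R.
Proof.
  intros HG A B0. induction A as [|a A IH]; intros delta Hd HA.
  - exists nil. split; [constructor|]. split; [auto|]. split; [simpl; tauto|].
    simpl. replace (0 - 0) with (RtoC 0) by ring. rewrite Cmod_0. lra.
  - inversion HA as [|? ? Ha HA']; subst.
    destruct (IH (delta / 2)%R) as (L & HL & H1 & H2 & H3 & H4); auto; [lra|].
    destruct (HG a (delta / 2)%R) as [B1 HB1]; [lra|].
    set (B := nodup eq_dec_classic (B0 ++ B1)).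
    assert (HB : NoDup B) by apply NoDup_nodup.
    assert (Hi : incl (B0 ++ B1) B) by apply incl_nodup.
    apply incl_app_inv in Hi; destruct Hi as [Hi0 Hi1].
    specialize (HB1 B HB Hi1).
    exists (map (pair a) B ++ L). repeat split.
    + apply NoDup_app; auto.
      * apply Injective_map_NoDup; auto. intros x y h; congruence.
      * intros p Hp Hp'. apply in_map_iff in Hp. destruct Hp as (b & <- & _).
        apply H1 in Hp'; auto.
    + intros p Hp. apply in_app_iff in Hp. destruct Hp as [Hp|Hp].
      * apply in_map_iff in Hp. destruct Hp as (b & <- & _). left; auto.
      * right; auto.
    + intros i j Hi' Hj. apply in_app_iff. destruct Hi' as [->|Hi'].
      * left. apply in_map, Hi0; auto.
      * right; auto.
    + rewrite fsum_app, fsum_map. simpl.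
      change (fsum (fun j => c a j) B) with (fsum (c a) B).
      set (x := fsum _ L) in *.
      replace (fsum (c a) B + x - (G a + fsum G A)) with
        ((fsum (c a) B - G a) + (x - fsum G A)) by ring.
      eapply Rle_lt_trans; [apply Cmod_triangle|lra].
    + rewrite asum_app, asum_map. simpl.
      change (asum (fun j => c a j) B) with (asum (c a) B).
      assert (h := Cmod_fsum_le (c a) B).
      assert (h' := Cmod_triangle (fsum (c a) B) (- (fsum (c a) B - G a))).
      rewrite Cmod_opp in h'.
      replace (fsum (c a) B + - (fsum (c a) B - G a)) with (G a) in h' by ring.
      lra.
Qed.

Lemma has_sum_marginal {I J} (c : I -> J -> C) (G : I -> C) (s : C) :
  (forall i, has_sum (c i) (G i)) ->
  has_sum (fun p => c (fst p) (snd p)) s -> has_sum G s.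
Proof.
  intros HG Hs eps He. destruct (Hs (eps / 2)%R) as [L0 H0]; [lra|].
  exists (map fst L0). intros A HA Hi.
  destruct (slices_approx c G HG A (map snd L0) (eps / 2)%R)
    as (L & HL & _ & H2 & H3 & _); auto; [lra|].
  assert (Hi' : incl L0 L).
  { intros [i j] Hp. apply H2.
    - apply (in_map fst) in Hp; apply Hi; auto.
    - apply (in_map snd) in Hp; auto. }
  specialize (H0 L HL Hi'). set (x := fsum _ L) in *.
  rewrite <- Cmod_opp in H3.
  replace (fsum G A - s) with (- (x - fsum G A) + (x - s)) by ring.
  eapply Rle_lt_trans; [apply Cmod_triangle|lra].
Qed.

Lemma summable_marginal {I J} (c : I -> J -> C) (G : I -> C) :
  (forall i, has_sum (c i) (G i)) ->
  summable (fun p => c (fst p) (snd p)) -> summable G.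
Proof.
  intros HG [M HM]. exists (M + 1)%R. intros A HA.
  destruct (slices_approx c G HG A nil 1%R) as (L & HL & _ & _ & _ & H4); auto; [lra|].
  specialize (HM L HL). lra.
Qed.

Lemma NoDup_list_prod {I J} (A : list I) (B : list J) :
  NoDup A -> NoDup B -> NoDup (list_prod A B).
Proof.
  intros HA HB. induction HA as [|a A Ha HA IH]; simpl; [constructor|].
  apply NoDup_app; auto.
  - apply Injective_map_NoDup; auto. intros x y h; congruence.
  - intros p Hp Hp'. apply in_map_iff in Hp. destruct Hp as (b & <- & _).
    apply in_prod_iff in Hp'. tauto.
Qed.

(** Tonelli's theorem. A finite set of pairs lies in a finite rectangle, over
    which the moduli can be summed slice by slice. *)
Lemma summable_prod {I J} (c : I -> J -> C) (G : I -> C) :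
  (forall i L, NoDup L -> asum (c i) L <= Cmod (G i))%R -> summable G ->
  summable (fun p => c (fst p) (snd p)).
Proof.
  intros HG [M HM]. exists M. intros L HL.
  set (A := nodup eq_dec_classic (map fst L)).
  set (B := nodup eq_dec_classic (map snd L)).
  assert (HA : NoDup A) by apply NoDup_nodup.
  assert (HB : NoDup B) by apply NoDup_nodup.
  apply Rle_trans with (asum (fun p => c (fst p) (snd p)) (list_prod A B)).
  - apply asum_incl; auto using NoDup_list_prod.
    intros [i j] Hp. apply in_prod; apply nodup_In.
    + apply (in_map fst) in Hp; auto.
    + apply (in_map snd) in Hp; auto.
  - apply Rle_trans with (asum G A); [|auto].
    clear HA. clearbody A. induction A as [|a A IH]; [simpl; lra|].
    simpl list_prod. rewrite asum_app, asum_map. simpl.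
    specialize (HG a B HB). unfold asum in HG at 1. unfold asum at 1. lra.
Qed.

(** Fubini's theorem. Both iterated sums equal the sum over all pairs, because
    summability of the family does not depend on the order of the indices. *)
Lemma fubini {I J} (c : I -> J -> C) (G : I -> C) (H : J -> C) :
  summable (fun p => c (fst p) (snd p)) ->
  (forall i, has_sum (c i) (G i)) -> (forall j, has_sum (fun i => c i j) (H j)) ->
  summable G /\ summable H /\ tsum G = tsum H.
Proof.
  intros Hc HG HH.
  assert (Hc' : summable (fun p : J * I => c (snd p) (fst p))).
  { apply (summable_inj (fun p : J * I => (snd p, fst p)) _) in Hc; [exact Hc|].
    intros [x y] [x' y'] h; simpl in h; congruence. }
  split; [|split].
  - apply summable_marginal with c; auto.
  - apply summable_marginal with (fun j i => c i j); auto.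
  - assert (Hs := tsum_spec _ Hc).
    rewrite (tsum_unique _ _ (has_sum_marginal c G _ HG Hs)).
    symmetry; apply tsum_unique.
    apply has_sum_marginal with (fun j i => c i j); auto.
    apply (has_sum_bij (fun p : J * I => (snd p, fst p)) (fun p => (snd p, fst p)))
      in Hs; auto; intros [x y]; auto.
Qed.

(** * Comparison with convergent series *)

Lemma sum_n_fsum (c : nat -> C) (N : nat) :
  sum_n c N = fsum c (seq 0 (S N)).
Proof.
  induction N as [|N IH].
  - rewrite sum_O. simpl. ring.
  - rewrite sum_Sn, IH, (seq_S (S N) 0), fsum_app. simpl.
    unfold plus; simpl. ring.
Qed.

Lemma sum_n_asum (c : nat -> C) (N : nat) :
  sum_n (fun k => Cmod (c k)) N = asum c (seq 0 (S N)).
Proof.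
  induction N as [|N IH].
  - rewrite sum_O. simpl. ring.
  - rewrite sum_Sn, IH, (seq_S (S N) 0), asum_app. simpl.
    unfold plus; simpl. ring.
Qed.

Lemma incl_seq_bound (L : list nat) : exists N, forall M, (N <= M)%nat -> incl L (seq 0 (S M)).
Proof.
  exists (list_max L). intros M HM x Hx. apply in_seq.
  assert (h := proj1 (list_max_le L (list_max L)) (le_n _)).
  rewrite Forall_forall in h. specialize (h x Hx). lia.
Qed.

Lemma is_series_C_unique (c : nat -> C) (s t : C) :
  is_series c s -> is_series c t -> s = t.
Proof.
  intros Hs Ht.
  exact (filterlim_locally_unique (V := C_NormedModule) _ _ _ Hs Ht).
Qed.

Lemma has_sum_is_series (c : nat -> C) (s : C) : has_sum c s -> is_series c s.
Proof.
  intros Hs. apply filterlim_locally. intros eps.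
  destruct (Hs eps (cond_pos eps)) as [L0 H0].
  destruct (incl_seq_bound L0) as [N HN].
  exists N. intros n Hn. rewrite sum_n_fsum.
  apply C_NormedModule_mixin_compat1. apply (H0 (seq 0 (S n))).
  - apply seq_NoDup.
  - apply HN; auto.
Qed.

(** A series whose terms are eventually nonnegative reals converges absolutely;
    real parts reduce this to real series with monotone partial sums. *)
Lemma is_series_summable (c : nat -> C) (s : C) (K : nat) :
  (forall k, (K <= k)%nat -> nneg (c k)) -> is_series c s -> summable c.
Proof.
  intros Hc Hs.
  assert (H1 : is_series (fun k => fst (c k)) (fst s)).
  { unfold is_series.
    apply (filterlim_ext (fun n => fst (sum_n c n))).
    - intros n. induction n as [|n IH]; [rewrite !sum_O; auto|].
      rewrite !sum_Sn, <- IH. auto.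
    - apply (filterlim_comp _ _ _ (sum_n c) fst _ (locally s)); [exact Hs|].
      destruct s as [x y]. apply (continuous_fst x y). }
  assert (H2 : ex_series (fun k => Cmod (c k))).
  { apply (ex_series_incr_n _ K).
    apply (ex_series_ext (fun k => fst (c (K + k)%nat))).
    - intros k. apply (f_equal fst (Hc (K + k)%nat ltac:(lia))).
    - apply (ex_series_incr_n (fun k => fst (c k)) K). eexists; exact H1. }
  destruct H2 as [t Ht].
  exists t. intros L HL. destruct (incl_seq_bound L) as [N HN].
  apply Rle_trans with (asum c (seq 0 (S N))).
  - apply asum_incl; auto using seq_NoDup.
  - rewrite <- sum_n_asum.
    apply (is_lim_seq_incr_compare (sum_n (fun k => Cmod (c k))) t); [exact Ht|].
    intros n. rewrite sum_Sn. unfold plus; simpl.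
    generalize (Cmod_ge_0 (c (S n))); lra.
Qed.

Lemma is_series_summable_neg (c : nat -> C) (s : C) (K : nat) :
  (forall k, (K <= k)%nat -> nneg (- c k)) -> is_series c s -> summable c.
Proof.
  intros Hc Hs.
  apply summable_le with (fun k => - c k).
  - intros k; rewrite Cmod_opp; lra.
  - apply (is_series_summable _ (- s) K); auto.
    apply (is_series_opp (V := C_NormedModule) c s Hs).
Qed.

(** Enumerates the negative half in the order in which [is_sumZ] sums it. *)
Definition negZ (k : nat) : Z := (- Z.of_nat (S k))%Z.

(** With [incl_halves], this lets a finite set of integers be chosen by
    choosing its negative and its nonnegative part independently. *)
Lemma NoDup_halves (A B : list nat) :
  NoDup A -> NoDup B -> NoDup (map negZ A ++ map Z.of_nat B).
Proof.
  intros HA HB. apply NoDup_app.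
  - apply Injective_map_NoDup; auto. unfold negZ; intros x y; lia.
  - apply Injective_map_NoDup; auto. intros x y; lia.
  - intros z Hz Hz'. apply in_map_iff in Hz, Hz'.
    destruct Hz as (x & Hx & _), Hz' as (y & Hy & _). unfold negZ in Hx; lia.
Qed.

Lemma incl_halves (L : list Z) (A B : list nat) :
  incl (map (fun z => Z.to_nat (- z - 1)) L) A -> incl (map Z.to_nat L) B ->
  incl L (map negZ A ++ map Z.of_nat B).
Proof.
  intros HA HB z Hz. apply in_app_iff. destruct (Z_lt_le_dec z 0) as [h|h].
  - left. apply in_map_iff. exists (Z.to_nat (- z - 1)).
    split; [unfold negZ; lia|]. apply HA.
    apply (in_map (fun z => Z.to_nat (- z - 1))); auto.
  - right. apply in_map_iff. exists (Z.to_nat z).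
    split; [lia|]. apply HB, in_map; auto.
Qed.

Lemma summable_Z (c : Z -> C) :
  summable (fun k => c (negZ k)) -> summable (fun k => c (Z.of_nat k)) ->
  summable c.
Proof.
  intros [M HM] [N HN]. exists (M + N)%R. intros L HL.
  set (A := nodup eq_dec_classic (map (fun z => Z.to_nat (- z - 1)) L)).
  set (B := nodup eq_dec_classic (map Z.to_nat L)).
  assert (HA : NoDup A) by apply NoDup_nodup.
  assert (HB : NoDup B) by apply NoDup_nodup.
  apply Rle_trans with (asum c (map negZ A ++ map Z.of_nat B)).
  - apply asum_incl; auto using NoDup_halves.
    apply incl_halves; apply incl_nodup.
  - rewrite asum_app, !asum_map. apply Rplus_le_compat; auto.
Qed.

(** A partial sum over the integers that covers enough of each half is close to
    the unordered sum and to the sum of the two one-sided limits. *)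
Lemma has_sum_is_sumZ (c : Z -> C) (s : C) :
  summable c -> has_sum c s -> is_sumZ c s.
Proof.
  intros Hc Hs.
  assert (Hn : summable (fun k => c (negZ k))).
  { apply summable_inj; auto. unfold negZ; intros x y; lia. }
  assert (Hp : summable (fun k => c (Z.of_nat k))).
  { apply summable_inj; auto. intros x y; lia. }
  apply tsum_spec in Hn, Hp.
  set (s1 := tsum (fun k => c (negZ k))) in *.
  set (s2 := tsum (fun k => c (Z.of_nat k))) in *.
  exists s1, s2. split; [|split].
  - exact (has_sum_is_series _ _ Hn).
  - exact (has_sum_is_series _ _ Hp).
  - apply Ceq_minus, Cmod_eq_0, Rle_antisym; [|apply Cmod_ge_0].
    apply le_epsilon; intros eps He.
    destruct (Hs (eps / 3)%R) as [L0 H0]; [lra|].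
    destruct (Hn (eps / 3)%R) as [L1 H1]; [lra|].
    destruct (Hp (eps / 3)%R) as [L2 H2]; [lra|].
    set (A := nodup eq_dec_classic
      (L1 ++ map (fun z => Z.to_nat (- z - 1)) L0)).
    set (B := nodup eq_dec_classic (L2 ++ map Z.to_nat L0)).
    assert (HA : NoDup A) by apply NoDup_nodup.
    assert (HB : NoDup B) by apply NoDup_nodup.
    destruct (incl_app_inv _ _ (incl_nodup _ : incl _ A)) as [A1 A0].
    destruct (incl_app_inv _ _ (incl_nodup _ : incl _ B)) as [B2 B0].
    specialize (H0 _ (NoDup_halves A B HA HB) (incl_halves _ _ _ A0 B0)).
    specialize (H1 A HA A1). specialize (H2 B HB B2).
    rewrite fsum_app, !fsum_map in H0.
    set (x := fsum _ A) in *. set (y := fsum _ B) in *.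
    replace (s - (s1 + s2)) with ((x - s1) + ((y - s2) + - (x + y - s))) by ring.
    rewrite <- Cmod_opp in H0.
    assert (h := Cmod_triangle (x - s1) ((y - s2) + - (x + y - s))).
    assert (h' := Cmod_triangle (y - s2) (- (x + y - s))).
    lra.
Qed.

Lemma is_sumZ_tsum (c : Z -> C) (s : C) :
  summable c -> is_sumZ c s -> s = tsum c.
Proof.
  intros Hc (s1 & s2 & H1 & H2 & ->).
  destruct (has_sum_is_sumZ c (tsum c) Hc (tsum_spec c Hc)) as (t1 & t2 & K1 & K2 & ->).
  f_equal; eapply is_series_C_unique; eauto.
Qed.

(** * Absolutely convergent products of Laurent series *)

Definition conv (a b : laurent) : laurent :=
  fun n => tsum (fun m => a m * b (n - m)%Z).

Definition mulable (a b : laurent) : Prop :=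
  forall n : Z, summable (fun m => a m * b (n - m)%Z).

(** The Euler operator [z d/dz]. It is a derivation like [d/dz] but does not
    shift the indices, which keeps the convolutions below aligned. *)
Definition theta (f : laurent) : laurent := fun n => RtoC (IZR n) * f n.

Lemma deriv_theta (f : laurent) (n : Z) : deriv f n = theta f (n + 1)%Z.
Proof. reflexivity. Qed.

Lemma conv_has_sum (a b : laurent) (n : Z) :
  mulable a b -> has_sum (fun m => a m * b (n - m)%Z) (conv a b n).
Proof. intros H; apply tsum_spec, H. Qed.

Lemma mulable_is_mul (a b : laurent) : mulable a b -> is_mul a b (conv a b).
Proof. intros H n. apply has_sum_is_sumZ; [apply H|apply conv_has_sum, H]. Qed.

Lemma mulable_le (a b a' b' : laurent) :
  (forall n, Cmod (a n) <= Cmod (a' n))%R ->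
  (forall n, Cmod (b n) <= Cmod (b' n))%R -> mulable a' b' -> mulable a b.
Proof.
  intros Ha Hb H n. eapply summable_le; [|apply (H n)].
  intros m; simpl. rewrite !Cmod_mult.
  apply Rmult_le_compat; auto using Cmod_ge_0.
Qed.

Lemma is_mul_nneg (a b p : laurent) :
  (forall n, nneg (a n)) -> (forall n, nneg (b n)) -> is_mul a b p ->
  mulable a b /\ p = conv a b.
Proof.
  intros Ha Hb Hp.
  assert (H : mulable a b).
  { intros n. destruct (Hp n) as (s1 & s2 & H1 & H2 & _).
    apply summable_Z; [apply (is_series_summable _ s1 0)|apply (is_series_summable _ s2 0)];
      auto; intros; apply nneg_mult; auto. }
  split; auto. apply functional_extensionality; intros n.
  apply is_sumZ_tsum; auto.
Qed.

(** Although the coefficients of the derivative of a nonnegative series change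
    sign, in each coefficient of the product all but finitely many terms of
    either half have the same sign; so the product converges absolutely. *)
Lemma is_mul_deriv_nneg (u f v : laurent) :
  (forall n, nneg (u n)) -> (forall n, nneg (f n)) -> is_mul u (deriv f) v ->
  mulable u (theta f).
Proof.
  intros Hu Hf Hv n. destruct (Hv (n - 1)%Z) as (s1 & s2 & H1 & H2 & _).
  assert (E : forall m, u m * deriv f (n - 1 - m)%Z = u m * theta f (n - m)%Z).
  { intros m. rewrite deriv_theta. do 2 f_equal. lia. }
  apply summable_Z.
  - apply (is_series_summable _ s1 (Z.to_nat (Z.abs n))).
    + intros k Hk. apply nneg_mult; auto. apply nneg_mult; auto.
      apply nneg_RtoC, IZR_le. unfold negZ; lia.
    + eapply is_series_ext; [|exact H1]. intros k; apply E.
  - apply (is_series_summable_neg _ s2 (Z.to_nat (Z.abs n))).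
    + intros k Hk. unfold theta.
      replace (- (u (Z.of_nat k) * (RtoC (IZR (n - Z.of_nat k)) * f (n - Z.of_nat k)%Z)))
        with (u (Z.of_nat k) * (RtoC (IZR (- (n - Z.of_nat k))) * f (n - Z.of_nat k)%Z))
        by (rewrite opp_IZR, RtoC_opp; ring).
      apply nneg_mult; auto. apply nneg_mult; auto.
      apply nneg_RtoC, IZR_le. lia.
    + eapply is_series_ext; [|exact H2]. intros k; apply E.
Qed.

(** The factor [n - m] has modulus at least 1 except at [m = n]. *)
Lemma mulable_of_theta (a b : laurent) : mulable a (theta b) -> mulable a b.
Proof.
  intros H n. apply (summable_except n _ (fun m => a m * theta b (n - m)%Z)); [|apply (H n)].
  intros m Hm; simpl. unfold theta. rewrite !Cmod_mult, Cmod_R, <- abs_IZR.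
  assert (1 <= IZR (Z.abs (n - m)))%R by (apply IZR_le; lia).
  apply Rmult_le_compat_l; [apply Cmod_ge_0|].
  rewrite <- (Rmult_1_l (Cmod (b (n - m)%Z))) at 1.
  apply Rmult_le_compat_r; [apply Cmod_ge_0|auto].
Qed.

Lemma conv_scal (s : C) (a b : laurent) (n : Z) :
  mulable a b -> conv (fun m => s * a m) b n = s * conv a b n.
Proof.
  intros H. apply tsum_unique.
  replace (fun m => s * a m * b (n - m)%Z) with (fun m => s * (a m * b (n - m)%Z))
    by (apply functional_extensionality; intros m; ring).
  apply has_sum_scal, conv_has_sum, H.
Qed.

(** The product rule comes from [n = m + (n - m)]. The existence of the product
    of [theta a] and [b] is a consequence, as a difference of the two products
    assumed to converge. *)
Lemma theta_conv (a b : laurent) (n : Z) :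
  mulable a b -> mulable a (theta b) ->
  theta (conv a b) n = conv (theta a) b n + conv a (theta b) n.
Proof.
  intros H1 H2.
  assert (H3 : has_sum (fun m => theta a m * b (n - m)%Z)
    (RtoC (IZR n) * conv a b n + (- (1)) * conv a (theta b) n)).
  { replace (fun m => theta a m * b (n - m)%Z) with
      (fun m => RtoC (IZR n) * (a m * b (n - m)%Z) +
        (- (1)) * (a m * theta b (n - m)%Z)).
    - apply has_sum_plus; apply has_sum_scal, conv_has_sum; auto.
    - apply functional_extensionality; intros m. unfold theta.
      rewrite minus_IZR, RtoC_minus. ring. }
  unfold conv at 2. rewrite (tsum_unique _ _ H3). unfold theta at 1. ring.
Qed.

Section Triple.

(** The triple product [a c b], dominated by [a' c' b], over all triples of
    indices with sum [n]. *)
Variables (a b c a' c' : laurent).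
Hypothesis HA : forall n, nneg (a' n).
Hypothesis HC : forall n, nneg (c' n).
Hypothesis Ha : forall n, (Cmod (a n) <= Cmod (a' n))%R.
Hypothesis Hc : forall n, (Cmod (c n) <= Cmod (c' n))%R.
Hypothesis HAC : mulable a' c'.
Hypothesis HACb : mulable (conv a' c') b.

Lemma triple_summable (n : Z) :
  summable (fun p : Z * Z =>
    a (snd p) * c (fst p - snd p)%Z * b (n - fst p)%Z).
Proof.
  apply (summable_prod (fun m i => a i * c (m - i)%Z * b (n - m)%Z)
    (fun m => conv a' c' m * b (n - m)%Z)); [|apply HACb].
  intros m L HL.
  set (r := RtoC (Cmod (b (n - m)%Z))).
  assert (Hr : nneg r) by apply nneg_RtoC, Cmod_ge_0.
  assert (Er : Cmod r = Cmod (b (n - m)%Z)).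
  { unfold r. rewrite Cmod_R, Rabs_pos_eq; auto using Cmod_ge_0. }
  rewrite Cmod_mult, <- Er, <- Cmod_mult, Cmult_comm.
  apply (asum_le_sum _ (fun i => r * (a' i * c' (m - i)%Z))); auto.
  - intros i. rewrite !Cmod_mult, Er, Rmult_comm.
    apply Rmult_le_compat_l; [apply Cmod_ge_0|].
    apply Rmult_le_compat; auto using Cmod_ge_0.
  - intros i. repeat apply nneg_mult; auto.
  - apply has_sum_scal, conv_has_sum, HAC.
Qed.

(** In terms of the indices [i], [j = m - i], [l = n - m] of the three factors,
    the pair [(m, i)] is sent to the pair with [j] and [l] exchanged. *)
Definition swap_index (n : Z) (p : Z * Z) : Z * Z := (n - fst p + snd p, snd p)%Z.

Lemma swap_indexK (n : Z) (p : Z * Z) : swap_index n (swap_index n p) = p.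
Proof. destruct p as [m i]; unfold swap_index; simpl; f_equal; lia. Qed.

Lemma triple_swap (n : Z) :
  (fun p : Z * Z => a (snd p) * b (fst p - snd p)%Z * c (n - fst p)%Z) =
  (fun p => (fun q : Z * Z => a (snd q) * c (fst q - snd q)%Z * b (n - fst q)%Z)
    (swap_index n p)).
Proof.
  apply functional_extensionality; intros [m i]; simpl.
  replace (n - m + i - i)%Z with (n - m)%Z by lia.
  replace (n - (n - m + i))%Z with (m - i)%Z by lia. ring.
Qed.

Lemma triple_summable_swap (n : Z) :
  summable (fun p : Z * Z =>
    a (snd p) * b (fst p - snd p)%Z * c (n - fst p)%Z).
Proof.
  rewrite triple_swap.
  assert (Hi : Injective (swap_index n)).
  { intros p q h. rewrite <- (swap_indexK n p), h. apply swap_indexK. }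
  exact (summable_inj (swap_index n) _ Hi (triple_summable n)).
Qed.

(** Both bracketings group the same absolutely convergent sum over triples of
    indices: by the index of the first two factors, in either order. *)
Lemma conv_right_comm : mulable a b ->
  mulable (conv a b) c /\ forall n, conv (conv a b) c n = conv (conv a c) b n.
Proof.
  intros Hab.
  assert (Hac : mulable a c) by (eapply mulable_le; eauto).
  assert (Hs1 : forall n m, has_sum (fun i => a i * b (m - i)%Z * c (n - m)%Z)
    (conv a b m * c (n - m)%Z)).
  { intros n m.
    replace (fun i => a i * b (m - i)%Z * c (n - m)%Z)
      with (fun i => c (n - m)%Z * (a i * b (m - i)%Z))
      by (apply functional_extensionality; intros i; ring).
    rewrite Cmult_comm. apply has_sum_scal, conv_has_sum, Hab. }
  assert (Hs2 : forall n m, has_sum (fun i => a i * c (m - i)%Z * b (n - m)%Z)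
    (conv a c m * b (n - m)%Z)).
  { intros n m.
    replace (fun i => a i * c (m - i)%Z * b (n - m)%Z)
      with (fun i => b (n - m)%Z * (a i * c (m - i)%Z))
      by (apply functional_extensionality; intros i; ring).
    rewrite Cmult_comm. apply has_sum_scal, conv_has_sum, Hac. }
  split.
  - intros n.
    apply (summable_marginal (fun m i => a i * b (m - i)%Z * c (n - m)%Z));
      [apply Hs1|apply triple_summable_swap].
  - intros n. assert (Ht := tsum_spec _ (triple_summable n)).
    set (t := tsum _) in Ht. transitivity t.
    + apply tsum_unique.
      apply (has_sum_marginal (fun m i => a i * b (m - i)%Z * c (n - m)%Z));
        [apply Hs1|].
      rewrite triple_swap.
      exact (has_sum_bij (swap_index n) (swap_index n) _ _
        (swap_indexK n) (swap_indexK n) Ht).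
    + symmetry; apply tsum_unique.
      apply (has_sum_marginal (fun m i => a i * c (m - i)%Z * b (n - m)%Z));
        [apply Hs2|exact Ht].
Qed.

(** Fixing the index of the third factor at [l] in the summable family of
    triples and dividing by the constant [c l] leaves the double product. *)
Lemma mulable_drop_factor (l : Z) : c l <> 0 -> mulable a b.
Proof.
  intros Hl m.
  assert (H := summable_inj (fun i : Z => (m, i)) _
    (fun x y h => f_equal snd h) (triple_summable_swap (m + l)%Z)).
  simpl in H. replace (m + l - m)%Z with l in H by lia.
  apply (summable_scal _ (/ c l)) in H.
  replace (fun i => a i * b (m - i)%Z)
    with (fun i => / c l * (a i * b (m - i)%Z * c l)); auto.
  apply functional_extensionality; intros i. field; auto.
Qed.

End Triple.

(** * Powers and the power rule *)

(** Unlike in [is_pow], the first power is also a product; [pw_1] shows that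
    this makes no difference, and it spares a case in each induction. As [tsum]
    is total, [pw] is meaningful only where the products converge. *)
Fixpoint pw (f : laurent) (k : nat) : laurent :=
  match k with
  | O => fun n => if Z.eq_dec n 0 then 1 else 0
  | S k' => conv (pw f k') f
  end.

(** What makes [f^k] and [|f|^k] computable by rearranging absolutely convergent
    sums: each of the products that build the power converges absolutely. *)
Definition abs_pows (f : laurent) (k : nat) : Prop :=
  forall j, (j < k)%nat -> mulable (pw (absl f) j) (absl f).

Lemma absl_nneg (f : laurent) (n : Z) : nneg (absl f n).
Proof. apply nneg_RtoC, Cmod_ge_0. Qed.

Lemma Cmod_absl (f : laurent) (n : Z) : Cmod (absl f n) = Cmod (f n).
Proof. unfold absl. rewrite Cmod_R, Rabs_pos_eq; auto using Cmod_ge_0. Qed.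

Lemma Cmod_theta_absl (f : laurent) (n : Z) :
  Cmod (theta (absl f) n) = Cmod (theta f n).
Proof. unfold theta. rewrite !Cmod_mult, Cmod_absl; auto. Qed.

Lemma pw0_mulable (f g : laurent) : mulable (pw f 0) g.
Proof.
  intros n. apply (summable_except 0%Z _ (fun _ => RtoC 0)).
  - intros m Hm; simpl. destruct (Z.eq_dec m 0); [contradiction|].
    rewrite Cmult_0_l; lra.
  - apply summable_0; auto.
Qed.

Lemma conv_pw0 (f g : laurent) : conv (pw f 0) g = g.
Proof.
  apply functional_extensionality; intros n. apply tsum_unique.
  assert (H : has_sum (fun m => pw f 0 m * g (n - m)%Z) (pw f 0 0%Z * g (n - 0)%Z)).
  { apply (has_sum_single 0%Z (fun m => pw f 0 m * g (n - m)%Z)).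
    intros m Hm; simpl. destruct (Z.eq_dec m 0); [contradiction|ring]. }
  rewrite Z.sub_0_r in H. simpl in H. rewrite Cmult_1_l in H. exact H.
Qed.

Lemma pw_1 (f : laurent) : pw f 1 = f.
Proof. apply conv_pw0. Qed.

Lemma abs_pows_le (f : laurent) (j k : nat) :
  (j <= k)%nat -> abs_pows f k -> abs_pows f j.
Proof. intros h H i Hi. apply H; lia. Qed.

Lemma pw_absl_nneg (f : laurent) (k : nat) :
  abs_pows f k -> forall n, nneg (pw (absl f) k n).
Proof.
  induction k as [|k IH]; intros H n.
  - simpl. destruct (Z.eq_dec n 0); apply nneg_RtoC; lra.
  - eapply has_sum_nneg; [|apply (conv_has_sum _ _ n (H k (le_n _)))].
    intros m. apply nneg_mult; [|apply absl_nneg].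
    apply IH. apply abs_pows_le with (S k); auto.
Qed.

Lemma pw_dom (f : laurent) (k : nat) :
  abs_pows f k -> forall n, (Cmod (pw f k n) <= Cmod (pw (absl f) k n))%R.
Proof.
  induction k as [|k IH]; intros H n; [simpl; lra|].
  assert (Hk : abs_pows f k) by (apply abs_pows_le with (S k); auto).
  assert (HF := H k (le_n _)).
  assert (Hf : mulable (pw f k) f).
  { apply (mulable_le _ _ _ _ (IH Hk)) with (2 := HF).
    intros m; rewrite Cmod_absl; lra. }
  eapply has_sum_le; [| |apply (conv_has_sum _ _ n Hf)|apply (conv_has_sum _ _ n HF)].
  - intros m; simpl. rewrite !Cmod_mult, Cmod_absl.
    apply Rmult_le_compat_r; auto using Cmod_ge_0.
  - intros m. apply nneg_mult; [|apply absl_nneg]. apply pw_absl_nneg; auto.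
Qed.

Lemma pw_mulable_le (f x y : laurent) (k : nat) :
  abs_pows f k -> (forall n, Cmod (x n) <= Cmod (y n))%R ->
  mulable (pw (absl f) k) y -> mulable (pw f k) x.
Proof. intros H Hx. apply mulable_le; auto. apply pw_dom, H. Qed.

Lemma abs_pows_is_pow (f : laurent) (k : nat) :
  abs_pows f k -> is_pow f k (pw f k).
Proof.
  induction k as [|k IH]; intros H; [simpl; auto|].
  destruct k as [|k].
  - intros n. rewrite pw_1; auto.
  - exists (pw f (S k)).
    assert (Hk : abs_pows f (S k)) by (apply abs_pows_le with (S (S k)); auto).
    split; [apply IH; auto|]. apply mulable_is_mul.
    apply pw_mulable_le with (absl f); auto.
    intros n; rewrite Cmod_absl; lra.
Qed.

(** For nonnegative series the existence of a power is the same as the absolute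
    convergence of all the products that lead to it. *)
Lemma is_pow_absl (f p : laurent) (k : nat) :
  is_pow (absl f) k p -> abs_pows f k /\ p = pw (absl f) k.
Proof.
  revert p; induction k as [|k IH]; intros p Hp.
  - split; [intros j Hj; lia|].
    apply functional_extensionality; intros n. apply Hp.
  - destruct k as [|k].
    + split.
      * intros j Hj. replace j with 0%nat by lia. apply pw0_mulable.
      * rewrite pw_1. apply functional_extensionality; intros n. apply Hp.
    + destruct Hp as (q & Hq & Hm). destruct (IH q Hq) as [H1 ->].
      apply is_mul_nneg in Hm; [|apply pw_absl_nneg; auto|apply absl_nneg].
      destruct Hm as [H2 ->]. split; auto.
      intros j Hj. destruct (Nat.eq_dec j (S k)) as [->|h]; auto.
      apply H1; lia.
Qed.

(** The power rule by induction with the product rule. The step needs the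
    hypothesis for the next lower power; it is inherited by cancelling a
    nonzero coefficient of [f]. *)
Lemma theta_pw (f : laurent) (k : nat) :
  abs_pows f (S k) -> mulable (pw (absl f) k) (theta (absl f)) ->
  forall n, theta (pw f (S k)) n = RtoC (INR (S k)) * conv (pw f k) (theta f) n.
Proof.
  induction k as [|k IH]; intros Hp Hm n.
  - rewrite pw_1, conv_pw0. simpl. ring.
  - assert (Hp1 : abs_pows f (S k)) by (apply abs_pows_le with (S (S k)); auto).
    assert (Hp0 : abs_pows f k) by (apply abs_pows_le with (S (S k)); auto).
    assert (HF : mulable (pw (absl f) k) (absl f)) by (apply Hp; lia).
    assert (Hth : forall x, (Cmod (theta f x) <= Cmod (theta (absl f) x))%R).
    { intros x; rewrite Cmod_theta_absl; lra. }
    assert (Hab : forall x, (Cmod (f x) <= Cmod (absl f x))%R).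
    { intros x; rewrite Cmod_absl; lra. }
    assert (HmF : mulable (pw (absl f) k) (theta (absl f))).
    { destruct (excluded_middle_informative (exists l, absl f l <> 0)) as [[l Hl]|Hn].
      - apply (mulable_drop_factor (pw (absl f) k) (theta (absl f)) (absl f)
          (pw (absl f) k) (absl f)) with l;
          auto using Rle_refl, absl_nneg, pw_absl_nneg.
      - assert (E : theta (absl f) = fun _ => 0).
        { apply functional_extensionality; intros x. unfold theta.
          destruct (excluded_middle_informative (absl f x = 0)) as [->|h]; [ring|].
          exfalso; eauto. }
        rewrite E. intros x. apply summable_0. intros m; ring. }
    assert (Hm0 : mulable (pw f k) (theta f))
      by (apply pw_mulable_le with (theta (absl f)); auto).
    assert (Hm1 : mulable (pw f (S k)) (theta f))
      by (apply pw_mulable_le with (theta (absl f)); auto).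
    assert (Hm2 : mulable (pw f (S k)) f)
      by (apply pw_mulable_le with (absl f); auto).
    destruct (conv_right_comm (pw f k) (theta f) f (pw (absl f) k) (absl f))
      as [Hc1 Hc2]; auto using absl_nneg, pw_absl_nneg, pw_dom.
    { apply mulable_le with (3 := Hm); auto. intros x; apply Rle_refl. }
    change (pw f (S (S k))) with (conv (pw f (S k)) f).
    rewrite theta_conv; auto.
    replace (theta (pw f (S k))) with
      (fun x => RtoC (INR (S k)) * conv (pw f k) (theta f) x)
      by (apply functional_extensionality; intros x; rewrite IH; auto).
    rewrite conv_scal, Hc2; auto.
    change (conv (pw f k) f) with (pw f (S k)).
    rewrite (S_INR (S k)), RtoC_plus. ring.
Qed.

(** * Degrees *)

Lemma deg_plus_ge (h : laurent) (N : nat) :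
  h (Z.of_nat N) <> 0 -> Rbar_le (Finite (INR N)) (deg_plus h).
Proof.
  intros H. unfold deg_plus. apply (proj1 (Lub_Rbar_correct _)). eauto.
Qed.

Lemma le_deg_plus (h : laurent) (k : nat) :
  Rbar_le (Finite (INR k)) (deg_plus h) ->
  k = 0%nat \/ exists N, (k <= N)%nat /\ h (Z.of_nat N) <> 0.
Proof.
  intros Hk. destruct k as [|k]; [auto|right].
  destruct (excluded_middle_informative
    (exists N, (S k <= N)%nat /\ h (Z.of_nat N) <> 0)) as [h0|h0]; auto.
  exfalso.
  assert (Hb : Rbar_le (deg_plus h) (Finite (INR k))).
  { apply (proj2 (Lub_Rbar_correct _)). intros x [->|(N & HN & ->)]; simpl.
    - apply pos_INR.
    - apply le_INR. destruct (le_lt_dec N k) as [h1|h1]; auto.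
      exfalso; apply h0; exists N; split; auto. }
  assert (h1 := Rbar_le_trans _ _ _ Hk Hb). rewrite S_INR in h1. simpl in h1. lra.
Qed.

(** Terms beyond the degree vanish, so the truncation may be ignored. *)
Lemma is_sum_upto_deg (h : laurent) (c : nat -> C) (s : C) :
  is_sum_upto (deg_plus h) (fun k => h (Z.of_nat k) * c k) s <->
  is_series (fun k => h (Z.of_nat k) * c k) s.
Proof.
  assert (E : forall k, (if Rbar_le_dec (Finite (INR k)) (deg_plus h)
    then h (Z.of_nat k) * c k else RtoC 0) = h (Z.of_nat k) * c k).
  { intros k. destruct (Rbar_le_dec (Finite (INR k)) (deg_plus h)) as [_|hk]; auto.
    destruct (excluded_middle_informative (h (Z.of_nat k) = 0)) as [->|h0]; [ring|].
    exfalso; apply hk, deg_plus_ge, h0. }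
  split; intros H; (eapply is_series_ext; [|exact H]); intros k; simpl.
  - apply E.
  - symmetry; apply E.
Qed.

Lemma deriv_power_series (g : laurent) : power_series g -> power_series (deriv g).
Proof.
  intros H n Hn. unfold deriv. destruct (Z.eq_dec n (-1)) as [->|h].
  - simpl. ring.
  - rewrite H by lia. ring.
Qed.

Lemma deriv_nat (g : laurent) (k : nat) :
  deriv g (Z.of_nat k) = RtoC (INR (S k)) * g (Z.of_nat (S k)).
Proof.
  unfold deriv. rewrite INR_IZR_INZ. rewrite Nat2Z.inj_succ. reflexivity.
Qed.

Lemma Cmod_deriv_absl (g : laurent) (n : Z) :
  Cmod (deriv (absl g) n) = Cmod (deriv g n).
Proof. apply Cmod_theta_absl. Qed.

(** * The chain rule *)

Section Chain.

Variables (g f u : laurent).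
Hypothesis hu : is_comp (deriv (absl g)) (absl f) u.

Let B (k : nat) : C := deriv (absl g) (Z.of_nat k).
Let beta (k : nat) : C := deriv g (Z.of_nat k).

Lemma deriv_absl_nneg (k : nat) : nneg (B k).
Proof.
  unfold B. rewrite deriv_nat. apply nneg_mult; [|apply absl_nneg].
  apply nneg_RtoC, pos_INR.
Qed.

Lemma comp_abs_pows (k : nat) : B k <> 0 -> abs_pows f k.
Proof.
  intros Hk. destruct hu as [_ (p & Hp & _)].
  apply (is_pow_absl f (p k)), Hp, deg_plus_ge, Hk.
Qed.

(** Where [B k] vanishes the power may fail to exist, and then nothing is known
    about [pw]; the factor [B k] makes the term harmless. *)
Lemma comp_terms_nneg (k : nat) (m : Z) : nneg (B k * pw (absl f) k m).
Proof.
  destruct (excluded_middle_informative (B k = 0)) as [->|h].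
  - rewrite Cmult_0_l. apply nneg_RtoC; lra.
  - apply nneg_mult; [apply deriv_absl_nneg|].
    apply pw_absl_nneg, comp_abs_pows, h.
Qed.

(** The composition is a series in the exponents; its terms are nonnegative, so
    it converges as an unordered sum. *)
Lemma comp_has_sum (m : Z) : has_sum (fun k => B k * pw (absl f) k m) (u m).
Proof.
  destruct hu as [_ (p & Hp & Hs)].
  assert (H : is_series (fun k => B k * pw (absl f) k m) (u m)).
  { eapply is_series_ext; [|exact (proj1 (is_sum_upto_deg _ _ _) (Hs m))].
    intros k; simpl.
    destruct (excluded_middle_informative (B k = 0)) as [h|h].
    - fold (B k). rewrite h. ring.
    - fold (B k). destruct (is_pow_absl f (p k) k) as [_ ->]; auto.
      apply Hp, deg_plus_ge, h. }
  assert (Hsum : summable (fun k => B k * pw (absl f) k m)).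
  { apply (is_series_summable _ _ 0 (fun k _ => comp_terms_nneg k m) H). }
  apply tsum_spec in Hsum.
  rewrite (is_series_C_unique _ _ _ H (has_sum_is_series _ _ Hsum)). exact Hsum.
Qed.

Lemma comp_nneg (m : Z) : nneg (u m).
Proof. eapply has_sum_nneg; [|apply comp_has_sum]. intros k; apply comp_terms_nneg. Qed.

(** All powers of [|f|] multiplied by [x] at once: since the terms summed over
    [k] give [u], absolute convergence of [u x] is that of the double family. *)
Lemma comp_family_summable (x : laurent) (n : Z) :
  mulable u x -> summable (fun p : Z * nat =>
    B (snd p) * pw (absl f) (snd p) (fst p) * x (n - fst p)%Z).
Proof.
  intros Hx.
  apply (summable_prod (fun m k => B k * pw (absl f) k m * x (n - m)%Z)
    (fun m => u m * x (n - m)%Z)); [|apply Hx].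
  intros m L HL.
  set (r := RtoC (Cmod (x (n - m)%Z))).
  assert (Hr : nneg r) by apply nneg_RtoC, Cmod_ge_0.
  assert (Er : Cmod r = Cmod (x (n - m)%Z)).
  { unfold r. rewrite Cmod_R, Rabs_pos_eq; auto using Cmod_ge_0. }
  rewrite Cmod_mult, <- Er, <- Cmod_mult, Cmult_comm.
  apply (asum_le_sum _ (fun k => r * (B k * pw (absl f) k m))); auto.
  - intros k. rewrite !Cmod_mult, Er, Rmult_comm. lra.
  - intros k. apply nneg_mult; auto using comp_terms_nneg.
  - apply has_sum_scal, comp_has_sum.
Qed.

Lemma comp_pw_mulable (x : laurent) (k : nat) :
  mulable u x -> B k <> 0 -> mulable (pw (absl f) k) x.
Proof.
  intros Hx Hk n.
  assert (H := summable_inj (fun m : Z => (m, k)) _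
    (fun y z h => f_equal fst h) (comp_family_summable x n Hx)).
  simpl in H. apply (summable_scal _ (/ B k)) in H.
  replace (fun m => pw (absl f) k m * x (n - m)%Z)
    with (fun m => / B k * (B k * pw (absl f) k m * x (n - m)%Z)); auto.
  apply functional_extensionality; intros m. field; auto.
Qed.

Hypothesis hmul : mulable u (theta (absl f)).

Lemma comp_mulable : mulable u (absl f).
Proof. apply mulable_of_theta, hmul. Qed.

Lemma abs_coef_neq0 (k : nat) : beta k <> 0 -> B k <> 0.
Proof.
  intros h h'. apply h, Cmod_eq_0. unfold beta.
  rewrite <- Cmod_deriv_absl. fold (B k). rewrite h', Cmod_0; auto.
Qed.

(** For [j < k] the products occur in the [k]-th power used by [u]. The last
    one, [|f|^k] times [|f|], is a slice of the product of [u] and [|f|]. *)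
Lemma chain_abs_pows (k : nat) : beta k <> 0 -> abs_pows f (S k).
Proof.
  intros Hk. apply abs_coef_neq0 in Hk. intros j Hj.
  destruct (Nat.eq_dec j k) as [->|h].
  - apply comp_pw_mulable; auto using comp_mulable.
  - apply (comp_abs_pows k Hk). lia.
Qed.

Lemma deriv_coef_neq0 (k : nat) : g (Z.of_nat (S k)) <> 0 -> beta k <> 0.
Proof.
  intros h. unfold beta. rewrite deriv_nat. apply Cmult_neq_0; auto.
  intros h'. apply RtoC_inj in h'. apply (not_0_INR (S k)); auto.
Qed.

Lemma chain_terms_le (k : nat) (m : Z) :
  (Cmod (beta k * pw f k m) <= Cmod (B k * pw (absl f) k m))%R.
Proof.
  rewrite !Cmod_mult. unfold B, beta at 1. rewrite Cmod_deriv_absl.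
  destruct (excluded_middle_informative (beta k = 0)) as [h|h].
  - fold (beta k). rewrite h, Cmod_0. lra.
  - apply Rmult_le_compat_l; [apply Cmod_ge_0|].
    apply pw_dom. apply abs_pows_le with (S k); auto using chain_abs_pows.
Qed.

(** The series [g' o f] and, up to the constant term, [g o f]. *)
Let U : laurent := fun m => tsum (fun k => beta k * pw f k m).
Let W : laurent := fun n => tsum (fun k => g (Z.of_nat (S k)) * pw f (S k) n).

Lemma U_summable (m : Z) : summable (fun k => beta k * pw f k m).
Proof.
  apply summable_le with (fun k => B k * pw (absl f) k m).
  - intros k; apply chain_terms_le.
  - exists (Cmod (u m)). apply asum_le_sum with (fun k => B k * pw (absl f) k m).
    + intros k; apply Rle_refl.
    + intros k; apply comp_terms_nneg.
    + apply comp_has_sum.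
Qed.

(** Summing the family of products of [B k * |f|^k] with [|f|] over the
    exponents first gives the terms [(k+1) |b_{k+1}| |f|^{k+1}], which dominate
    those of [g o f]. *)
Lemma W_summable (n : Z) : summable (fun k => g (Z.of_nat (S k)) * pw f (S k) n).
Proof.
  assert (Hfam := comp_family_summable (absl f) n comp_mulable).
  apply summable_le with (fun k => B k * pw (absl f) (S k) n).
  - intros k. rewrite !Cmod_mult.
    destruct (excluded_middle_informative (g (Z.of_nat (S k)) = 0)) as [->|h].
    + rewrite Cmod_0, Rmult_0_l. apply Rmult_le_pos; apply Cmod_ge_0.
    + apply Rmult_le_compat; try apply Cmod_ge_0.
      * unfold B. rewrite Cmod_deriv_absl, deriv_nat, Cmod_mult, Cmod_R.
        rewrite Rabs_pos_eq by apply pos_INR. rewrite S_INR.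
        generalize (Cmod_ge_0 (g (Z.of_nat (S k)))) (pos_INR k). nra.
      * apply pw_dom, chain_abs_pows, deriv_coef_neq0, h.
  - apply (summable_marginal
      (fun k m => B k * pw (absl f) k m * absl f (n - m)%Z)).
    + intros k. destruct (excluded_middle_informative (B k = 0)) as [h|h].
      * rewrite h. rewrite Cmult_0_l.
        replace (fun m => 0 * pw (absl f) k m * absl f (n - m)%Z)
          with (fun m : Z => RtoC 0)
          by (apply functional_extensionality; intros m; ring).
        apply (has_sum_single 0%Z (fun _ => RtoC 0)). auto.
      * replace (fun m => B k * pw (absl f) k m * absl f (n - m)%Z)
          with (fun m => B k * (pw (absl f) k m * absl f (n - m)%Z))
          by (apply functional_extensionality; intros m; ring).
        apply has_sum_scal. apply (conv_has_sum (pw (absl f) k)).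
        apply comp_pw_mulable; auto using comp_mulable.
    + apply (summable_inj (fun p : nat * Z => (snd p, fst p)) _) in Hfam;
        [exact Hfam|].
      intros [x y] [x' y'] h; simpl in h; congruence.
Qed.

(** The double family of terms [beta k f^k_m (theta f)_(n-m)] is summed in both
    orders; the inner sums over [m] are evaluated by the power rule. *)
Lemma chain_rule (n : Z) :
  mulable U (theta f) /\ conv U (theta f) n = RtoC (IZR n) * W n.
Proof.
  assert (Hmf : forall k, beta k <> 0 -> mulable (pw f k) (theta f)).
  { intros k Hk. apply pw_mulable_le with (theta (absl f)).
    - apply abs_pows_le with (S k); auto using chain_abs_pows.
    - intros x; rewrite Cmod_theta_absl; lra.
    - apply comp_pw_mulable; auto using abs_coef_neq0. }
  assert (HG : forall l m, has_sum (fun k => beta k * pw f k m * theta f (l - m)%Z)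
    (U m * theta f (l - m)%Z)).
  { intros l m.
    replace (fun k => beta k * pw f k m * theta f (l - m)%Z)
      with (fun k => theta f (l - m)%Z * (beta k * pw f k m))
      by (apply functional_extensionality; intros k; ring).
    rewrite Cmult_comm. apply has_sum_scal, tsum_spec, U_summable. }
  assert (HH : forall l k, has_sum (fun m => beta k * pw f k m * theta f (l - m)%Z)
    (RtoC (IZR l) * (g (Z.of_nat (S k)) * pw f (S k) l))).
  { intros l k.
    destruct (excluded_middle_informative (beta k = 0)) as [h|h].
    - replace (g (Z.of_nat (S k))) with (RtoC 0).
      + rewrite h, Cmult_0_l, Cmult_0_r.
        replace (fun m => 0 * pw f k m * theta f (l - m)%Z)
          with (fun m : Z => RtoC 0)
          by (apply functional_extensionality; intros m; ring).
        apply (has_sum_single 0%Z (fun _ => RtoC 0)). auto.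
      + destruct (excluded_middle_informative (g (Z.of_nat (S k)) = 0)) as [->|h']; auto.
        exfalso; apply (deriv_coef_neq0 k h'), h.
    - replace (RtoC (IZR l) * (g (Z.of_nat (S k)) * pw f (S k) l))
        with (beta k * conv (pw f k) (theta f) l).
      + replace (fun m => beta k * pw f k m * theta f (l - m)%Z)
          with (fun m => beta k * (pw f k m * theta f (l - m)%Z))
          by (apply functional_extensionality; intros m; ring).
        apply has_sum_scal, (conv_has_sum (pw f k)); auto.
      + replace (RtoC (IZR l) * (g (Z.of_nat (S k)) * pw f (S k) l))
          with (g (Z.of_nat (S k)) * theta (pw f (S k)) l)
          by (unfold theta; ring).
        rewrite theta_pw; auto using chain_abs_pows, comp_pw_mulable, abs_coef_neq0.
        unfold beta. rewrite deriv_nat. ring. }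
  assert (Hsum : forall l, summable (fun p : Z * nat =>
    beta (snd p) * pw f (snd p) (fst p) * theta f (l - fst p)%Z)).
  { intros l. eapply summable_le; [|apply (comp_family_summable (theta (absl f)) l hmul)].
    intros [m k]; simpl. rewrite 2!(Cmod_mult _ (theta _ _)), Cmod_theta_absl.
    apply Rmult_le_compat_r; [apply Cmod_ge_0|apply chain_terms_le]. }
  split.
  - intros l. apply (fubini (fun m k => beta k * pw f k m * theta f (l - m)%Z) _ _
      (Hsum l) (HG l) (HH l)).
  - destruct (fubini (fun m k => beta k * pw f k m * theta f (n - m)%Z) _ _
      (Hsum n) (HG n) (HH n)) as (_ & _ & E).
    unfold conv. rewrite E. apply tsum_unique, has_sum_scal, tsum_spec, W_summable.
Qed.

Lemma comp_deriv_exists : power_series g -> is_comp (deriv g) f U.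
Proof.
  intros hg. split; [apply deriv_power_series, hg|].
  exists (pw f). split.
  - intros k Hk. apply abs_pows_is_pow.
    destruct (le_deg_plus _ _ Hk) as [->|(N & HN & h)].
    + intros j Hj; lia.
    + apply abs_pows_le with (S N); [lia|]. apply chain_abs_pows, h.
  - intros m. apply is_sum_upto_deg, has_sum_is_series, tsum_spec, U_summable.
Qed.

Lemma comp_exists : power_series g ->
  is_comp g f (fun n => g 0%Z * pw f 0 n + W n).
Proof.
  intros hg. split; [auto|].
  exists (pw f). split.
  - intros k Hk. apply abs_pows_is_pow.
    destruct (le_deg_plus _ _ Hk) as [->|(N & HN & h)].
    + intros j Hj; lia.
    + destruct N as [|N].
      * replace k with 0%nat by lia. intros j Hj; lia.
      * apply abs_pows_le with (S N); auto. apply chain_abs_pows, deriv_coef_neq0, h.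
  - intros n. apply is_sum_upto_deg.
    (* [W] starts at the first power; the constant term is split off. *)
    apply (is_series_decr_1 (V := C_NormedModule)
      (fun k => g (Z.of_nat k) * pw f k n)).
    replace (plus _ _) with (W n).
    + apply has_sum_is_series, tsum_spec, W_summable.
    + change (W n = g 0%Z * pw f 0 n + W n + - (g 0%Z * pw f 0 n)). ring.
Qed.

End Chain.

Theorem proposition5p13 (g f : laurent) (hg : power_series g)
  (hgf : exists u v : laurent,
     is_comp (deriv (absl g)) (absl f) u /\ is_mul u (deriv (absl f)) v) :
  exists u v w : laurent,
    is_comp (deriv g) f u /\ is_mul u (deriv f) v /\
    is_comp g f w /\
    (forall n : Z, v n = deriv w n).
Proof.
  destruct hgf as (u & v & hu & hv).
  apply is_mul_deriv_nneg in hv; [|apply (comp_nneg g f u hu)|apply absl_nneg].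
  destruct (chain_rule g f u hu hv 0) as [Hmul _].
  assert (Hcr := fun n => proj2 (chain_rule g f u hu hv n)).
  do 3 eexists. split; [|split; [|split]].
  - exact (comp_deriv_exists g f u hu hv hg).
  - intros n. specialize (Hmul (n + 1)%Z).
    assert (E : (fun m => tsum (fun k => deriv g (Z.of_nat k) * pw f k m) *
        theta f (n + 1 - m)%Z) =
      (fun m => tsum (fun k => deriv g (Z.of_nat k) * pw f k m) * deriv f (n - m)%Z)).
    { apply functional_extensionality; intros m. rewrite deriv_theta.
      do 2 f_equal. lia. }
    rewrite <- E. apply has_sum_is_sumZ; [exact Hmul|]. apply tsum_spec, Hmul.
  - exact (comp_exists g f u hu hv hg).
  - intros n. cbv beta. rewrite deriv_theta.
    etransitivity; [exact (Hcr (n + 1)%Z)|].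
    (* The constant term of [g o f] is killed by the factor [n + 1]. *)
    unfold theta. simpl pw. destruct (Z.eq_dec (n + 1) 0) as [->|_]; ring.
Qed.
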